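(* Suppose that $u:A\rightarrow B$ and $v:B\rightarrow C$ are ring morphisms. (i) If $u$ and $v$ are strong PSI-morphisms, then so is $vu$. (ii) If $vu$ is a strong PSI-morphism, then so is $v$.
   Context: All rings are commutative and unitary, and ring morphisms are unitary. For $P\in\mathrm{Spec}(A)$, $k_A(P)=A_P/PA_P$ denotes the residue field of $A$ at $P$. A ring morphism $u:A\to B$ is a strong PSI-morphism if for every $P\in\mathrm{Spec}(A)$ with $k_A(P)\otimes_A B\neq 0$, the canonical map $k_A(P)\to k_A(P)\otimes_A B$ is an isomorphism. *)

(* Defs.v *)
From HB Require Import structures.
From mathcomp Require Import all_boot all_algebra.
From mathcomp Require Import boolp.
From mathcomp Require Import ring.

Set Implicit Arguments.
Unset Strict Implicit.
Unset Printing Implicit Defensive.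

Import GRing.Theory.
Local Open Scope ring_scope.
Local Open Scope quotient_scope.

(* The zero ring is allowed throughout, whence comPzRingType. The structure   *)
(* prime_idealr of ring_quotient.v is only available over an nzRingType.      *)

Section PrimeIdeals.

Variable A : comPzRingType.

Definition is_prime_ideal (P : {pred A}) : Prop :=
  [/\ 0 \in P,
      {in P &, forall x y, x + y \in P},
      forall a x, x \in P -> a * x \in P,
      1 \notin P
    & forall x y, x * y \in P -> x \in P \/ y \in P].

Record Spec := PrimeIdeal {
  prime_pred :> {pred A};
  prime_predP : is_prime_ideal prime_pred
}.

End PrimeIdeals.

Section PrimeIdealTheory.

Variables (A : comPzRingType) (P : Spec A).

Lemma prime0 : 0 \in P. Proof. by case: (prime_predP P). Qed.

Lemma primeD x y : x \in P -> y \in P -> x + y \in P.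
Proof. by case: (prime_predP P) => _ + _ _ _; apply. Qed.

Lemma primeMl a x : x \in P -> a * x \in P.
Proof. by case: (prime_predP P) => _ _ + _ _; apply. Qed.

Lemma prime1 : 1 \notin P. Proof. by case: (prime_predP P). Qed.

Lemma primeM_notin x y : x \notin P -> y \notin P -> x * y \notin P.
Proof.
move=> xP yP; apply/negP; case: (prime_predP P) => _ _ _ _ /[apply].
by case; apply/negP.
Qed.

End PrimeIdealTheory.

(* The localization A_P: the class of (a, s) with s outside P is a / s.       *)

Section Localization.

Variables (A : comPzRingType) (P : Spec A).

Definition denom := {s : A | s \notin P}.

Definition denom1 : denom := exist _ 1 (prime1 P).

Definition denomM (s t : denom) : denom :=
  exist _ (sval s * sval t) (primeM_notin (svalP s) (svalP t)).

Definition loc_rel (x y : A * denom) : bool :=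
  `[< exists u : denom, sval u * (x.1 * sval y.2) = sval u * (y.1 * sval x.2) >].

Lemma loc_rel_refl : reflexive loc_rel.
Proof. by move=> x; apply/asboolP; exists denom1. Qed.

Lemma loc_rel_sym : symmetric loc_rel.
Proof. by move=> x y; apply/asboolP/asboolP => -[u e]; exists u. Qed.

Lemma loc_rel_trans : transitive loc_rel.
Proof.
move=> [b t] [a s] [c r] /asboolP[u /= e1] /asboolP[v /= e2]; apply/asboolP.
exists (denomM (denomM u v) t) => /=.
transitivity (sval v * sval r * (sval u * (a * sval t))); first by ring.
rewrite e1.
transitivity (sval u * sval s * (sval v * (b * sval r))); first by ring.
by rewrite e2; ring.
Qed.

Canonical loc_equiv := EquivRel loc_rel loc_rel_refl loc_rel_sym loc_rel_trans.

Definition localization := {eq_quot loc_rel}.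

HB.instance Definition _ := Choice.on localization.
HB.instance Definition _ := EqQuotient.on localization.

Definition loc_frac (a : A) (s : denom) : localization :=
  \pi_localization (a, s).

Lemma loc_fracP a s b t :
  (exists u : denom, sval u * (a * sval t) = sval u * (b * sval s)) <->
  loc_frac a s = loc_frac b t.
Proof.
split=> [h|/eqmodP/asboolP //].
by apply/eqmodP/asboolP.
Qed.

Lemma loc_fracW (T : localization -> Prop) :
  (forall a s, T (loc_frac a s)) -> forall x, T x.
Proof. by move=> h x; rewrite -[x]reprK; case: (repr x) => a s; apply: h. Qed.

Definition loc_add (x y : localization) : localization :=
  let: (a, s) := repr x in let: (b, t) := repr y in
  loc_frac (a * sval t + b * sval s) (denomM s t).

Definition loc_opp (x : localization) : localization :=
  let: (a, s) := repr x in loc_frac (- a) s.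

Definition loc_mul (x y : localization) : localization :=
  let: (a, s) := repr x in let: (b, t) := repr y in
  loc_frac (a * b) (denomM s t).

Lemma loc_reprP a s : exists u : denom,
  let: (b, t) := repr (loc_frac a s) in
  sval u * (b * sval s) = sval u * (a * sval t).
Proof.
case E: (repr (loc_frac a s)) => [b t].
by apply/loc_fracP; rewrite /loc_frac -E reprK.
Qed.

Lemma loc_addE a s b t : loc_add (loc_frac a s) (loc_frac b t) =
  loc_frac (a * sval t + b * sval s) (denomM s t).
Proof.
rewrite /loc_add; have := loc_reprP a s; have := loc_reprP b t.
case: (repr _) => b' t' [v e2]; case: (repr _) => a' s' [u e1].
apply/loc_fracP; exists (denomM u v) => /=.
transitivity (sval v * (sval t * sval t') * (sval u * (a' * sval s))
  + sval u * (sval s * sval s') * (sval v * (b' * sval t))); first by ring.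
by rewrite e1 e2; ring.
Qed.

Lemma loc_oppE a s : loc_opp (loc_frac a s) = loc_frac (- a) s.
Proof.
rewrite /loc_opp; have := loc_reprP a s; case: (repr _) => a' s' [u e].
by apply/loc_fracP; exists u; rewrite !mulNr !mulrN e.
Qed.

Lemma loc_mulE a s b t :
  loc_mul (loc_frac a s) (loc_frac b t) = loc_frac (a * b) (denomM s t).
Proof.
rewrite /loc_mul; have := loc_reprP a s; have := loc_reprP b t.
case: (repr _) => b' t' [v e2]; case: (repr _) => a' s' [u e1].
apply/loc_fracP; exists (denomM u v) => /=.
transitivity ((sval u * (a' * sval s)) * (sval v * (b' * sval t))); first by ring.
by rewrite e1 e2; ring.
Qed.

Lemma loc_frac_eq a s b t : a * sval t = b * sval s ->
  loc_frac a s = loc_frac b t.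
Proof. by move=> e; apply/loc_fracP; exists denom1; rewrite e. Qed.

Lemma loc_addA : associative loc_add.
Proof.
elim/loc_fracW=> a s; elim/loc_fracW=> b t; elim/loc_fracW=> c r.
by rewrite !loc_addE; apply: loc_frac_eq => /=; ring.
Qed.

Lemma loc_addC : commutative loc_add.
Proof.
elim/loc_fracW=> a s; elim/loc_fracW=> b t.
by rewrite !loc_addE; apply: loc_frac_eq => /=; ring.
Qed.

Lemma loc_add0 : left_id (loc_frac 0 denom1) loc_add.
Proof.
by elim/loc_fracW=> a s; rewrite loc_addE; apply: loc_frac_eq => /=; ring.
Qed.

Lemma loc_addN : left_inverse (loc_frac 0 denom1) loc_opp loc_add.
Proof.
elim/loc_fracW=> a s; rewrite loc_oppE loc_addE.
by apply: loc_frac_eq => /=; ring.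
Qed.

HB.instance Definition _ :=
  GRing.isZmodule.Build localization loc_addA loc_addC loc_add0 loc_addN.

Lemma loc_mulA : associative loc_mul.
Proof.
elim/loc_fracW=> a s; elim/loc_fracW=> b t; elim/loc_fracW=> c r.
by rewrite !loc_mulE; apply: loc_frac_eq => /=; ring.
Qed.

Lemma loc_mulC : commutative loc_mul.
Proof.
elim/loc_fracW=> a s; elim/loc_fracW=> b t.
by rewrite !loc_mulE; apply: loc_frac_eq => /=; ring.
Qed.

Lemma loc_mul1 : left_id (loc_frac 1 denom1) loc_mul.
Proof.
by elim/loc_fracW=> a s; rewrite loc_mulE; apply: loc_frac_eq => /=; ring.
Qed.

Lemma loc_mulDl : left_distributive loc_mul loc_add.
Proof.
elim/loc_fracW=> a s; elim/loc_fracW=> b t; elim/loc_fracW=> c r.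
by rewrite !(loc_addE, loc_mulE); apply: loc_frac_eq => /=; ring.
Qed.

Lemma loc_1neq0 : loc_frac 1 denom1 != 0.
Proof.
apply/eqP => /loc_fracP[u] /=; rewrite !mulr1 mulr0 => u0.
by move: (svalP u); rewrite u0 prime0.
Qed.

HB.instance Definition _ := GRing.Zmodule_isComNzRing.Build localization
  loc_mulA loc_mulC loc_mul1 loc_mulDl loc_1neq0.

Lemma loc_fracD a s b t : loc_frac a s + loc_frac b t =
  loc_frac (a * sval t + b * sval s) (denomM s t).
Proof. exact: loc_addE. Qed.

Lemma loc_fracN a s : - loc_frac a s = loc_frac (- a) s.
Proof. exact: loc_oppE. Qed.

Lemma loc_fracM a s b t :
  loc_frac a s * loc_frac b t = loc_frac (a * b) (denomM s t).
Proof. exact: loc_mulE. Qed.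

Definition loc_map (a : A) : localization := loc_frac a denom1.

Lemma loc_map_zmod_morphism : zmod_morphism loc_map.
Proof.
move=> a b; rewrite /loc_map loc_fracN loc_fracD.
by apply: loc_frac_eq => /=; ring.
Qed.

Lemma loc_map_monoid_morphism : monoid_morphism loc_map.
Proof.
split=> // a b; rewrite /loc_map loc_fracM.
by apply: loc_frac_eq => /=; ring.
Qed.

HB.instance Definition _ := GRing.isZmodMorphism.Build A localization
  loc_map loc_map_zmod_morphism.
HB.instance Definition _ := GRing.isMonoidMorphism.Build A localization
  loc_map loc_map_monoid_morphism.

End Localization.

(* The ideal P A_P of A_P generated by the image of P, and A_P / P A_P.       *)

Section ResidueField.

Variables (A : comPzRingType) (P : Spec A).

Definition loc_max : {pred localization P} := fun x =>
  `[< exists (n : nat) (c : 'I_n -> localization P) (p : 'I_n -> A),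
        (forall i, p i \in P) /\ x = \sum_(i < n) c i * loc_map P (p i) >].

Lemma loc_maxP x : x \in loc_max <->
  exists (a : A) (s : denom P), a \in P /\ x = loc_frac a s.
Proof.
split=> [/asboolP[n [c [p [pP ->]]]]|[a [s [aP ->]]]].
  elim/big_ind: _ => [|_ _ [a [s [aP ->]]] [b [t [bP ->]]]|i _].
  - by exists 0, (denom1 P); split; first exact: prime0.
  - exists (a * sval t + b * sval s), (denomM s t).
    split; last by rewrite -loc_fracD.
    by apply: primeD; rewrite mulrC primeMl.
  elim/loc_fracW: (c i) => b t.
  exists (b * p i), (denomM t (denom1 P)); split; first exact: primeMl.
  by rewrite -loc_fracM.
apply/asboolP; exists 1%N, (fun=> loc_frac 1 s), (fun=> a); split=> //.
rewrite big_ord1 loc_fracM.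
by apply: loc_frac_eq => /=; ring.
Qed.

Lemma loc_max_idealr : idealr_closed loc_max.
Proof.
split.
- by apply/loc_maxP; exists 0, (denom1 P); split; first exact: prime0.
- apply/negP => /loc_maxP[a [s [aP /loc_fracP[u /= e]]]].
  have: sval u * (1 * sval s) \in P.
    by rewrite e; apply: primeMl; rewrite mulr1.
  by rewrite mul1r; apply/negP; exact: primeM_notin (svalP u) (svalP s).
move=> x u v /loc_maxP[a [s [aP ->]]] /loc_maxP[b [t [bP ->]]].
elim/loc_fracW: x => c r; apply/loc_maxP.
exists (c * a * sval t + b * sval (denomM r s)), (denomM (denomM r s) t).
split; last by rewrite -loc_fracD -loc_fracM.
by apply: primeD; rewrite mulrC !primeMl.
Qed.

HB.instance Definition _ :=
  isIdealr.Build (localization P) loc_max loc_max_idealr.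

Definition residue_field := {ideal_quot loc_max}.

HB.instance Definition _ := GRing.ComNzRing.on residue_field.

Definition residue_map (a : A) : residue_field :=
  \pi_residue_field (loc_map P a).

Lemma residue_map_zmod_morphism : zmod_morphism residue_map.
Proof. by move=> a b; rewrite /residue_map !rmorphB. Qed.

Lemma residue_map_monoid_morphism : monoid_morphism residue_map.
Proof. by split=> [|a b]; rewrite /residue_map ?rmorph1 ?rmorphM. Qed.

HB.instance Definition _ := GRing.isZmodMorphism.Build A residue_field
  residue_map residue_map_zmod_morphism.
HB.instance Definition _ := GRing.isMonoidMorphism.Build A residue_field
  residue_map residue_map_monoid_morphism.

End ResidueField.

(* The tensor product over A of the A-algebras f : A -> S and g : A -> T. The *)
(* list [:: (x1, y1); ..; (xn, yn)] stands for the sum of the xi (x) yi; the  *)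
(* lists form the free commutative monoid on S * T up to trel_comm, and       *)
(* trel_zero makes the quotient a group, with - (x (x) y) = (- x) (x) y.      *)

Section TensorProduct.

Variables (A S T : comPzRingType).
Variables (f : {rmorphism A -> S}) (g : {rmorphism A -> T}).

Inductive trel : seq (S * T) -> seq (S * T) -> Prop :=
| trel_refl s : trel s s
| trel_sym s t : trel s t -> trel t s
| trel_trans s t r : trel s t -> trel t r -> trel s r
| trel_comm s t : trel (s ++ t) (t ++ s)
| trel_cat s s' t t' : trel s s' -> trel t t' -> trel (s ++ t) (s' ++ t')
| trel_zero y : trel [:: (0, y)] [::]
| trel_addl x x' y : trel [:: (x + x', y)] [:: (x, y); (x', y)]
| trel_addr x y y' : trel [:: (x, y + y')] [:: (x, y); (x, y')]
| trel_bal a x y : trel [:: (f a * x, y)] [:: (x, g a * y)].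

Definition trelb (s t : seq (S * T)) : bool := `[< trel s t >].

Lemma trelb_refl : reflexive trelb.
Proof. by move=> s; apply/asboolP/trel_refl. Qed.

Lemma trelb_sym : symmetric trelb.
Proof. by move=> s t; apply/asboolP/asboolP => /trel_sym. Qed.

Lemma trelb_trans : transitive trelb.
Proof.
move=> s t r /asboolP ts /asboolP sr; apply/asboolP.
exact: trel_trans ts sr.
Qed.

Canonical tensor_equiv := EquivRel trelb trelb_refl trelb_sym trelb_trans.

Definition tensor := {eq_quot trelb}.

HB.instance Definition _ := Choice.on tensor.
HB.instance Definition _ := EqQuotient.on tensor.

Definition tcls (s : seq (S * T)) : tensor := \pi_tensor s.

Lemma tclsP s t : trel s t <-> tcls s = tcls t.
Proof. by split=> [h|/eqmodP/asboolP //]; apply/eqmodP/asboolP. Qed.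

Lemma tclsW (Q : tensor -> Prop) : (forall s, Q (tcls s)) -> forall x, Q x.
Proof. by move=> h x; rewrite -[x]reprK; apply: h. Qed.

Definition pmul (p q : S * T) : S * T := (p.1 * q.1, p.2 * q.2).

Definition lopp (s : seq (S * T)) := [seq (- p.1, p.2) | p <- s].

Definition lmul (s t : seq (S * T)) := [seq pmul p q | p <- s, q <- t].

Definition tadd (x y : tensor) : tensor := tcls (repr x ++ repr y).

Definition topp (x : tensor) : tensor := tcls (lopp (repr x)).

Definition tmul (x y : tensor) : tensor := tcls (lmul (repr x) (repr y)).

Lemma trel_repr s : trel (repr (tcls s)) s.
Proof. by apply/tclsP; rewrite /tcls reprK. Qed.

Lemma perm_trel s t : perm_eq s t -> trel s t.
Proof.
move=> st; have: forall r1 r2 r3,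
    trel s (r1 ++ r2 ++ r3) -> trel s (r2 ++ r1 ++ r3).
  move=> r1 r2 r3 h; apply: trel_trans h _; rewrite !catA.
  by apply: trel_cat (trel_refl _); apply: trel_comm.
by move/catCA_perm_ind; apply; [exact: st|apply: trel_refl].
Qed.

Lemma taddE s t : tadd (tcls s) (tcls t) = tcls (s ++ t).
Proof. by apply/tclsP/trel_cat; apply: trel_repr. Qed.

Lemma trel_opp s t : trel s t -> trel (lopp s) (lopp t).
Proof.
elim=> {s t}.
- by move=> *; apply: trel_refl.
- by move=> *; apply: trel_sym.
- by move=> s t r _ st _ tr; apply: trel_trans st tr.
- by move=> s t; rewrite /lopp !map_cat; apply: trel_comm.
- by move=> s s' t t' _ ss' _ tt'; rewrite /lopp !map_cat; apply: trel_cat.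
- by move=> y /=; rewrite oppr0; apply: trel_zero.
- by move=> x x' y /=; rewrite opprD; apply: trel_addl.
- by move=> x y y'; apply: trel_addr.
- by move=> a x y /=; rewrite -mulrN; apply: trel_bal.
Qed.

Lemma toppE s : topp (tcls s) = tcls (lopp s).
Proof. by apply/tclsP/trel_opp/trel_repr. Qed.

Lemma trel_pmul p s t : trel s t -> trel (map (pmul p) s) (map (pmul p) t).
Proof.
case: p => u v; elim=> {s t}.
- by move=> *; apply: trel_refl.
- by move=> *; apply: trel_sym.
- by move=> s t r _ st _ tr; apply: trel_trans st tr.
- by move=> s t; rewrite !map_cat; apply: trel_comm.
- by move=> s s' t t' _ ss' _ tt'; rewrite !map_cat; apply: trel_cat.
- by move=> y; rewrite /= /pmul /= mulr0; apply: trel_zero.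
- by move=> x x' y; rewrite /= /pmul /= mulrDr; apply: trel_addl.
- by move=> x y y'; rewrite /= /pmul /= mulrDr; apply: trel_addr.
- move=> a x y; rewrite /= /pmul /= [u * _]mulrCA [v * (_ * _)]mulrCA.
  exact: trel_bal.
Qed.

Lemma lmulC s t : perm_eq (lmul s t) (lmul t s).
Proof.
elim: s => [|p s IHs]; first by rewrite /lmul allpairs0r.
have /permPl h := perm_allpairs_consr (T := fun=> (S * T)%type)
  (fun x y => pmul x y) t (fun=> p) (fun=> s).
rewrite perm_sym; apply: perm_trans h _.
apply: perm_cat; last by rewrite perm_sym.
suff -> : [seq pmul q p | q <- t] = map (pmul p) t by apply: perm_refl.
by apply: eq_map => q; rewrite /pmul (mulrC q.1) (mulrC q.2).
Qed.

Lemma trel_mulr s t t' : trel t t' -> trel (lmul s t) (lmul s t').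
Proof.
move=> tt'; elim: s => [|p s IHs] /=; first exact: trel_refl.
by apply: trel_cat IHs; apply: trel_pmul.
Qed.

Lemma trel_mul s s' t t' : trel s s' -> trel t t' ->
  trel (lmul s t) (lmul s' t').
Proof.
move=> ss' tt'; apply: trel_trans (trel_mulr _ tt') _.
apply: trel_trans (perm_trel (lmulC _ _)) _.
apply: trel_trans (perm_trel (lmulC _ _)).
exact: trel_mulr.
Qed.

Lemma tmulE s t : tmul (tcls s) (tcls t) = tcls (lmul s t).
Proof. by apply/tclsP/trel_mul; apply: trel_repr. Qed.

Lemma taddA : associative tadd.
Proof.
elim/tclsW=> s; elim/tclsW=> t; elim/tclsW=> r.
by rewrite !taddE catA.
Qed.

Lemma taddC : commutative tadd.
Proof.
by elim/tclsW=> s; elim/tclsW=> t; rewrite !taddE; apply/tclsP/trel_comm.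
Qed.

Lemma tadd0 : left_id (tcls [::]) tadd.
Proof. by elim/tclsW=> s; rewrite taddE. Qed.

Lemma taddN : left_inverse (tcls [::]) topp tadd.
Proof.
elim/tclsW=> s; rewrite toppE taddE; apply/tclsP.
elim: s => [|[x y] s IHs]; first exact: trel_refl.
apply: (@trel_trans _ ([:: (- x, y); (x, y)] ++ (lopp s ++ s))).
  apply: perm_trel => /=; rewrite perm_cons.
  by rewrite -cat1s -[_ :: (lopp s ++ s)]cat1s perm_catCA.
apply: (@trel_trans _ ([::] ++ [::])); last exact: trel_refl.
apply: trel_cat IHs; apply: trel_trans (trel_sym (trel_addl _ _ _)) _.
by rewrite addNr; apply: trel_zero.
Qed.

HB.instance Definition _ :=
  GRing.isZmodule.Build tensor taddA taddC tadd0 taddN.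

Lemma lmul_catl s t r : lmul (s ++ t) r = lmul s r ++ lmul t r.
Proof. exact: allpairs_cat. Qed.

Lemma lmul_cons p s t : lmul (p :: s) t = map (pmul p) t ++ lmul s t.
Proof. by []. Qed.

Lemma tmulA : associative tmul.
Proof.
elim/tclsW=> s; elim/tclsW=> t; elim/tclsW=> r.
rewrite !tmulE; congr tcls; elim: s => //= p s IHs.
rewrite !lmul_cons lmul_catl -IHs; congr (_ ++ _).
elim: t {IHs} => //= q t IHt.
rewrite !lmul_cons map_cat IHt; congr (_ ++ _).
by rewrite -map_comp; apply: eq_map => o; rewrite /pmul /= !mulrA.
Qed.

Lemma tmulC : commutative tmul.
Proof.
elim/tclsW=> s; elim/tclsW=> t; rewrite !tmulE.
exact/tclsP/perm_trel/lmulC.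
Qed.

Lemma tmul1 : left_id (tcls [:: (1, 1)]) tmul.
Proof.
elim/tclsW=> s; rewrite tmulE /lmul /= cats0; congr tcls.
by rewrite -[RHS]map_id; apply: eq_map => -[x y]; rewrite /pmul /= !mul1r.
Qed.

Lemma tmulDl : left_distributive tmul tadd.
Proof.
elim/tclsW=> s; elim/tclsW=> t; elim/tclsW=> r.
by rewrite !(taddE, tmulE) lmul_catl.
Qed.

HB.instance Definition _ := GRing.Zmodule_isComPzRing.Build tensor
  tmulA tmulC tmul1 tmulDl.

Lemma tclsD s t : tcls s + tcls t = tcls (s ++ t).
Proof. exact: taddE. Qed.

Lemma tclsN s : - tcls s = tcls (lopp s).
Proof. exact: toppE. Qed.

Lemma tclsM s t : tcls s * tcls t = tcls (lmul s t).
Proof. exact: tmulE. Qed.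

Definition tens (x : S) (y : T) : tensor := tcls [:: (x, y)].

Definition tens_inl (x : S) : tensor := tens x 1.

Lemma tens_inl_zmod_morphism : zmod_morphism tens_inl.
Proof.
move=> x y; rewrite /tens_inl /tens tclsN tclsD.
exact/tclsP/trel_addl.
Qed.

Lemma tens_inl_monoid_morphism : monoid_morphism tens_inl.
Proof.
split=> // x y; rewrite /tens_inl /tens tclsM.
by rewrite /lmul /= /pmul /= mulr1.
Qed.

HB.instance Definition _ := GRing.isZmodMorphism.Build S tensor
  tens_inl tens_inl_zmod_morphism.
HB.instance Definition _ := GRing.isMonoidMorphism.Build S tensor
  tens_inl tens_inl_monoid_morphism.

End TensorProduct.

Definition ring_iso (R S : pzRingType) (h : {rmorphism R -> S}) : Prop :=
  exists k : {rmorphism S -> R}, cancel h k /\ cancel k h.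

Definition strong_PSI (A B : comPzRingType) (u : {rmorphism A -> B}) : Prop :=
  forall P : Spec A,
    (exists z : tensor (residue_map P) u, z != 0) ->
    ring_iso (tens_inl (residue_map P) u).

(* Main.v *)
Require Import Defs.
From HB Require Import structures.
From mathcomp Require Import all_boot all_algebra.
From mathcomp Require Import boolp.
From mathcomp Require Import ring.

Set Implicit Arguments.
Unset Strict Implicit.
Unset Printing Implicit Defensive.

(** For a prime P of A write k(P) for its residue field.  As k(P) is a field
    and k(P) (x)_A B is spanned by the x (x) b, the map k(P) -> k(P) (x)_A B
    is bijective as soon as the target is nonzero and each 1 (x) b has the form
    x (x) 1 ([strong_PSIP]).  This condition passes along any ring morphism
    that sends each x (x) 1 to some y (x) 1 and each 1 (x) c to 1 (x) c.  Such
    morphisms between fibres come from residue field maps: a morphism phi from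
    a ring to a field factors through the residue field of the ring at the
    prime ker phi ([residue_field_at_kernel]).

    (ii) Let Q be a prime of B and P its preimage in A.  The map k(P) -> k(Q)
    induces k(P) (x)_A C -> k(Q) (x)_B C.  If the target is nonzero so is the
    source, and the condition for vu at P gives the one for v at Q.

    (i) Let P be a prime of A with k(P) (x)_A C nonzero.  Then k(P) (x)_A B is
    nonzero, because it maps to k(P) (x)_A C, so u identifies it with k(P) and
    b |-> 1 (x) b becomes a morphism phi : B -> k(P).  With Q = ker phi, the
    map k(Q) -> k(P) and the identity of C induce
    k(Q) (x)_B C -> k(P) (x)_A C: on B they agree because
    phi(b) (x) 1 = 1 (x) v(b), the image of phi(b) (x) 1 = 1 (x) b.  Again the
    source is nonzero, and the condition for v at Q gives the one for vu at
    P. *)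

Import GRing.Theory.
Local Open Scope ring_scope.
Local Open Scope quotient_scope.

(** * Residue fields *)

(** The field axiom on inverses, stated as a property so that it applies to
    [residue_field] with its commutative ring structure. *)
Definition nonzero_invertible (D : comPzRingType) : Prop :=
  forall x : D, x != 0 -> exists y, x * y = 1.

Section ResidueFieldTheory.

Variables (A : comPzRingType) (P : Spec A).

Lemma residue_map_eq0 (a : A) : residue_map P a = 0 <-> a \in P.
Proof.
rewrite -[0](rmorph0 (\pi_(residue_field P))) (rwP eqP).
rewrite -Quotient.idealrBE subr0 loc_maxP.
split=> [[b [s [bP /loc_fracP[t /= e]]]]|aP]; last first.
  by exists a, (denom1 P).
apply: contraT => aP.
have: sval t * (a * sval s) \notin P.
  exact: primeM_notin (svalP t) (primeM_notin aP (svalP s)).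
by rewrite e mulr1 primeMl.
Qed.

Lemma residue_map_invertible (s : A) :
  s \notin P -> exists y, residue_map P s * y = 1.
Proof.
move=> sP; pose t : denom P := exist _ s sP.
exists (\pi_(residue_field P) (loc_frac 1 t)).
have e : loc_map P s * loc_frac 1 t = loc_map P 1.
  by rewrite /loc_map loc_fracM; apply: loc_frac_eq => /=; ring.
by rewrite /residue_map -rmorphM e !rmorph1.
Qed.

Lemma residue_field_frac (x : residue_field P) :
  exists a s, s \notin P /\ residue_map P s * x = residue_map P a.
Proof.
rewrite -[x]reprK; elim/loc_fracW: (repr x) => a s.
exists a, (sval s); split; first exact: (svalP s).
have e : loc_map P (sval s) * loc_frac a s = loc_map P a.
  by rewrite /loc_map loc_fracM; apply: loc_frac_eq => /=; ring.
by rewrite /residue_map -rmorphM e.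
Qed.

Lemma residue_field_nonzero_invertible : nonzero_invertible (residue_field P).
Proof.
move=> x x0; have [a [s [sP e]]] := residue_field_frac x.
have [t st] := residue_map_invertible sP.
have aP : a \notin P.
  apply: contra x0 => /residue_map_eq0 a0.
  by rewrite -[x]mul1r -st mulrAC e a0 mul0r.
have [y ay] := residue_map_invertible aP.
by exists (residue_map P s * y); rewrite mulrA [x * _]mulrC e.
Qed.

End ResidueFieldTheory.

Section Kernel.

Variables (A : comPzRingType) (D : comNzRingType) (g : {rmorphism A -> D}).
Hypothesis Dfield : nonzero_invertible D.

Lemma nonzero_invertible_mulI (x y z : D) : x != 0 -> x * y = x * z -> y = z.
Proof.
by move=> /Dfield[t xt] e; rewrite -[y]mul1r -[z]mul1r -xt ![x * t * _]mulrAC e.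
Qed.

Lemma kernel_prime : is_prime_ideal [pred a | g a == 0].
Proof.
split=> [|x y|a x||x y]; rewrite !inE.
- by rewrite rmorph0.
- by move=> /eqP gx /eqP gy; rewrite rmorphD gx gy addr0.
- by move=> /eqP gx; rewrite rmorphM gx mulr0.
- by rewrite rmorph1 oner_neq0.
rewrite rmorphM => /eqP gxy; have [gx|gx] := eqVneq (g x) 0; first by left.
right; apply/eqP; apply: (nonzero_invertible_mulI gx).
by rewrite gxy mulr0.
Qed.

(** The map k(ker g) -> D induced by g sends x to the solution d of
    g s * d = g a whenever s * x = a in k(ker g), with s outside ker g.
    Describing it by its graph makes additivity and multiplicativity
    consequences of the uniqueness of d. *)
Lemma residue_field_at_kernel :
  exists (P : Spec A) (h : {rmorphism residue_field P -> D}),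
    forall a, h (residue_map P a) = g a.
Proof.
pose P := PrimeIdeal kernel_prime; exists P.
have inP a : (a \in P) = (g a == 0) by [].
have gE a b : residue_map P a = residue_map P b -> g a = g b.
  move=> /eqP; rewrite -subr_eq0 -rmorphB => /eqP/residue_map_eq0.
  by rewrite inP rmorphB subr_eq0 => /eqP.
pose graph x d := exists a s,
  [/\ s \notin P, residue_map P s * x = residue_map P a & g s * d = g a].
have graph_total x : exists d, graph x d.
  have [a [s [sP e]]] := residue_field_frac x.
  have [t st] : exists t, g s * t = 1 by apply: Dfield; rewrite -inP.
  by exists (t * g a), a, s; split=> //; rewrite mulrA st mul1r.
have graph_fun x d d' : graph x d -> graph x d' -> d = d'.
  move=> [a [s [sP ex ed]]] [a' [s' [sP' ex' ed']]].
  have gss' : g (s * s') != 0 by rewrite -inP primeM_notin.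
  apply: (nonzero_invertible_mulI gss'); rewrite rmorphM.
  have: g (s' * a) = g (s * a').
    by apply: gE; rewrite !rmorphM /= -ex -ex'; ring.
  by rewrite !rmorphM -ed -ed' => e; rewrite mulrAC mulrC e mulrA.
pose h x := projT1 (cid (graph_total x)).
have hP x : graph x (h x) by exact: projT2 (cid (graph_total x)).
have hE x d : graph x d -> h x = d by apply: graph_fun.
have h_res a : h (residue_map P a) = g a.
  by apply: hE; exists a, 1; rewrite prime1 !rmorph1 !mul1r.
have hB : zmod_morphism h.
  move=> x y; have [a [s [sP ex ed]]] := hP x; have [b [t [tP ey ee]]] := hP y.
  apply: hE; exists (t * a - s * b), (s * t).
  split; first exact: primeM_notin.
    by rewrite !(rmorphB, rmorphM) /= -ex -ey; ring.
  by rewrite !(rmorphB, rmorphM) -ed -ee; ring.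
have hM : monoid_morphism h.
  split=> [|x y]; first by rewrite -(rmorph1 (residue_map P)) h_res rmorph1.
  have [a [s [sP ex ed]]] := hP x; have [b [t [tP ey ee]]] := hP y.
  apply: hE; exists (a * b), (s * t).
  split; first exact: primeM_notin.
    by rewrite !rmorphM /= -ex -ey; ring.
  by rewrite !rmorphM -ed -ee; ring.
pose hBi := GRing.isZmodMorphism.Build _ _ h hB.
pose hMi := GRing.isMonoidMorphism.Build _ _ h hM.
by exists (HB.pack_for {rmorphism residue_field P -> D} h hBi hMi).
Qed.

End Kernel.

(** * Tensor products of algebras *)

Section TensorTheory.

Variables (A S T : comPzRingType).
Variables (f : {rmorphism A -> S}) (g : {rmorphism A -> T}).

Definition tens_inr (y : T) : tensor f g := tens f g 1 y.

Lemma tens_inr_zmod_morphism : zmod_morphism tens_inr.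
Proof.
move=> x y; apply/esym/eqP; rewrite subr_eq /tens_inr /tens tclsD; apply/eqP.
by apply/tclsP; rewrite -{1}[x](subrK y); apply: trel_addr.
Qed.

Lemma tens_inr_monoid_morphism : monoid_morphism tens_inr.
Proof.
split=> // x y; rewrite /tens_inr /tens tclsM.
by rewrite /lmul /= /pmul /= mulr1.
Qed.

HB.instance Definition _ := GRing.isZmodMorphism.Build T (tensor f g)
  tens_inr tens_inr_zmod_morphism.
HB.instance Definition _ := GRing.isMonoidMorphism.Build T (tensor f g)
  tens_inr tens_inr_monoid_morphism.

Lemma tens_inl_inr (a : A) : tens_inl f g (f a) = tens_inr (g a).
Proof.
by apply/tclsP; have := trel_bal f g a 1 1; rewrite !mulr1.
Qed.

Lemma tcls_sum (s : seq (S * T)) :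
  tcls f g s = \sum_(p <- s) tens_inl f g p.1 * tens_inr p.2.
Proof.
elim: s => [|[x y] s IHs]; first by rewrite big_nil.
rewrite big_cons -IHs -cat1s -tclsD; congr (_ + _).
by rewrite /tens_inl /tens_inr /tens tclsM /lmul /= /pmul /= mulr1 mul1r.
Qed.

Lemma tensor_universal (D : comPzRingType)
    (a : {rmorphism S -> D}) (b : {rmorphism T -> D}) :
    (forall x, a (f x) = b (g x)) ->
  exists h : {rmorphism tensor f g -> D},
    (forall x, h (tens_inl f g x) = a x) /\ (forall y, h (tens_inr y) = b y).
Proof.
move=> fg; pose l s := \sum_(p <- s : seq (S * T)) a p.1 * b p.2.
have l_trel s t : trel f g s t -> l s = l t.
  rewrite /l; elim=> {s t}.
  - by [].
  - by [].
  - by move=> s t r _ -> _ ->.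
  - by move=> s t; rewrite !big_cat /= addrC.
  - by move=> s s' t t' _ e _ e'; rewrite !big_cat /= e e'.
  - by move=> y; rewrite big_seq1 big_nil /= rmorph0 mul0r.
  - by move=> x x' y; rewrite !big_cons !big_nil /= rmorphD mulrDl !addr0.
  - by move=> x y y'; rewrite !big_cons !big_nil /= rmorphD mulrDr !addr0.
  - move=> c x y; rewrite !big_seq1 /= !rmorphM fg; ring.
pose h (x : tensor f g) := l (repr x).
have hE s : h (tcls f g s) = l s by apply/l_trel/trel_repr.
have hB : zmod_morphism h.
  elim/tclsW=> s; elim/tclsW=> t; rewrite tclsN tclsD !hE /l big_cat /lopp.
  rewrite big_map -sumrN; congr (_ + _).
  by apply: eq_bigr => p _; rewrite rmorphN mulNr.
have hM : monoid_morphism h.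
  split; first by rewrite [h _]hE /l big_seq1 /= !rmorph1 mulr1.
  elim/tclsW=> s; elim/tclsW=> t; rewrite tclsM !hE /l /lmul.
  rewrite big_allpairs_dep big_distrl; apply: eq_bigr => p _ /=.
  by rewrite big_distrr; apply: eq_bigr => q _ /=; rewrite !rmorphM; ring.
pose hBi := GRing.isZmodMorphism.Build _ _ h hB.
pose hMi := GRing.isMonoidMorphism.Build _ _ h hM.
exists (HB.pack_for {rmorphism tensor f g -> D} h hBi hMi).
by split=> [x|y]; rewrite [LHS]hE /l big_seq1 rmorph1 ?mulr1 ?mul1r.
Qed.

End TensorTheory.

(** * Strong PSI-morphisms *)

Lemma bijective_ring_iso (R S : pzRingType) (h : {rmorphism R -> S}) :
  injective h -> (forall y, exists x, h x = y) -> ring_iso h.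
Proof.
move=> h_inj h_surj; pose k y := projT1 (cid (h_surj y)).
have hk : cancel k h by move=> y; exact: projT2 (cid (h_surj y)).
have kB : zmod_morphism k by move=> x y; apply: h_inj; rewrite rmorphB !hk.
have kM : monoid_morphism k.
  by split=> [|x y]; apply: h_inj; rewrite ?rmorph1 ?rmorphM !hk.
pose kBi := GRing.isZmodMorphism.Build _ _ k kB.
pose kMi := GRing.isMonoidMorphism.Build _ _ k kM.
exists (HB.pack_for {rmorphism S -> R} k kBi kMi); split=> [x|] //.
by apply: h_inj; rewrite [LHS]hk.
Qed.

(** The map x |-> x (x) 1 out of a field is injective once its target is
    nonzero, and its image is a subring; so bijectivity only has to be tested
    on the elements 1 (x) b, which generate the tensor product as a ring
    together with that image. *)
Lemma strong_PSIP (A B : comPzRingType) (u : {rmorphism A -> B}) :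
  strong_PSI u <->
  forall P : Spec A, (1 : tensor (residue_map P) u) != 0 ->
    forall b, exists x,
      tens_inl (residue_map P) u x = tens_inr (residue_map P) u b.
Proof.
split=> [PSI P nz b|gen P [z z0]].
  have [k [_ kK]] := PSI P (ex_intro (fun z => z != 0) 1 nz).
  by exists (k (tens_inr _ _ b)); apply: kK.
have nz : (1 : tensor (residue_map P) u) != 0.
  by apply: contra z0 => /eqP e; rewrite -[z]mul1r e mul0r.
apply: bijective_ring_iso.
  apply: raddf_inj => x x0; apply: contraNeq nz.
  move=> /residue_field_nonzero_invertible[y xy].
  by rewrite -(rmorph1 (tens_inl (residue_map P) u)) -xy rmorphM x0 mul0r.
elim/tclsW=> s; rewrite tcls_sum.
elim/big_ind: _ => [|_ _ [x <-] [y <-]|[x b] _ /=].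
- by exists 0; rewrite rmorph0.
- by exists (x + y); rewrite rmorphD.
by have [y <-] := gen P nz b; exists (x * y); rewrite rmorphM.
Qed.

Lemma rmorph_neq0 (R S : pzRingType) (h : {rmorphism R -> S}) :
  (1 : S) != 0 -> (1 : R) != 0.
Proof. by apply: contra => /eqP e; rewrite -(rmorph1 h) e rmorph0. Qed.

Section Composition.

Variables (A B C : comPzRingType).
Variables (u : {rmorphism A -> B}) (v : {rmorphism B -> C}).

(** At P, the prime of B at which to use v is the kernel of the map
    b |-> 1 (x) b from B to k(P) (x)_A B = k(P). *)
Lemma strong_PSI_comp : strong_PSI u -> strong_PSI v -> strong_PSI (v \o u).
Proof.
move=> PSIu /strong_PSIP genv; apply/strong_PSIP => P nzC c.
have [chg [chg_l chg_r]] : exists h :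
    {rmorphism tensor (residue_map P) u -> tensor (residue_map P) (v \o u)},
    (forall x, h (tens_inl _ _ x) = tens_inl _ _ x) /\
    (forall b, h (tens_inr _ _ b) = tens_inr _ _ (v b)).
  apply: (tensor_universal (a := tens_inl (residue_map P) (v \o u))
    (b := tens_inr (residue_map P) (v \o u) \o v)) => a.
  exact: tens_inl_inr.
have nzB := rmorph_neq0 chg nzC.
have [k [inlK kK]] := PSIu P (ex_intro (fun z => z != 0) 1 nzB).
have [Q [j jE]] := residue_field_at_kernel (k \o tens_inr (residue_map P) u)
  (@residue_field_nonzero_invertible _ P).
(* Over B the two maps agree since phi(b) (x) 1 = 1 (x) b before applying chg,
   where phi(b) = k (1 (x) b). *)
have [psi [psi_l psi_r]] : exists h :
    {rmorphism tensor (residue_map Q) v -> tensor (residue_map P) (v \o u)},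
    (forall x, h (tens_inl _ _ x) = tens_inl _ _ (j x)) /\
    (forall y, h (tens_inr _ _ y) = tens_inr _ _ y).
  apply: (tensor_universal (a := tens_inl (residue_map P) (v \o u) \o j)
    (b := tens_inr (residue_map P) (v \o u))) => b.
  by rewrite /= jE /= -chg_l kK chg_r.
have [x e] := genv Q (rmorph_neq0 psi nzC) c.
by exists (j x); rewrite -psi_l e psi_r.
Qed.

(** The fibre of v over Q receives a map from the fibre of vu over the preimage
    of Q, under which every 1 (x) c is the image of 1 (x) c. *)
Lemma strong_PSI_cancel : strong_PSI (v \o u) -> strong_PSI v.
Proof.
move=> /strong_PSIP gen; apply/strong_PSIP => Q nz c.
have [P [j jE]] := residue_field_at_kernel (residue_map Q \o u)
  (@residue_field_nonzero_invertible _ Q).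
have [theta [theta_l theta_r]] : exists h :
    {rmorphism tensor (residue_map P) (v \o u) -> tensor (residue_map Q) v},
    (forall x, h (tens_inl _ _ x) = tens_inl _ _ (j x)) /\
    (forall y, h (tens_inr _ _ y) = tens_inr _ _ y).
  apply: (tensor_universal (a := tens_inl (residue_map Q) v \o j)
    (b := tens_inr (residue_map Q) v)) => a.
  by rewrite /= jE /= tens_inl_inr.
have [x e] := gen P (rmorph_neq0 theta nz) c.
by exists (j x); rewrite -theta_l e theta_r.
Qed.

End Composition.

Theorem theorem3p13 (A B C : comPzRingType)
  (u : {rmorphism A -> B}) (v : {rmorphism B -> C}) :
  (strong_PSI u -> strong_PSI v -> strong_PSI (v \o u)) /\
  (strong_PSI (v \o u) -> strong_PSI v).
Proof. by split; [exact: strong_PSI_comp|exact: strong_PSI_cancel]. Qed.
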